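(* Let $\mathcal{L}$ be a first-order language and let $\mathcal{M}$ be an $\mathcal{L}$-structure. If $\theta \subseteq \psi$ are congruences on $\mathcal{M}$, then $$\frac{(\mathcal{M}/\theta)}{(\psi/\theta)} \cong \frac{\mathcal{M}}{\psi}.$$
   Context: The universe of an $\mathcal{L}$-structure $\mathcal{M}$ is denoted $M$; constants are $0$-ary function symbols. A strong homomorphism $f\colon \mathcal{M} \to \mathcal{N}$ of $\mathcal{L}$-structures is a map $M \to N$ such that $f(F^{\mathcal{M}}(x_1,\dots,x_n)) = F^{\mathcal{N}}(f(x_1),\dots,f(x_n))$ for every $n$-ary function symbol $F$, and $R^{\mathcal{M}}(x_1,\dots,x_n) \iff R^{\mathcal{N}}(f(x_1),\dots,f(x_n))$ for every $n$-ary relation symbol $R$, for all $x_1,\dots,x_n \in M$. Isomorphisms $\cong$ are bijective strong homomorphisms. A congruence on $\mathcal{M}$ is an equivalence relation $\theta$ on $M$ such that whenever $(x_i,y_i) \in \theta$ for $1 \le i \leq n$: $(F^{\mathcal{M}}(x_1,\dots,x_n), F^{\mathcal{M}}(y_1,\dots,y_n)) \in \theta$ for every $n$-ary function symbol $F$, and $R^{\mathcal{M}}(x_1,\dots,x_n) \iff R^{\mathcal{M}}(y_1,\dots,y_n)$ for every $n$-ary relation symbol $R$. For a congruence $\theta$ on $\mathcal{M}$, the quotient $\mathcal{M}/\theta$ is the $\mathcal{L}$-structure with universe $M/\theta = \{[x]_\theta \mid x \in M\}$, $F^{\mathcal{M}/\theta}([x_1]_\theta,\dots,[x_n]_\theta)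 = [F^{\mathcal{M}}(x_1,\dots,x_n)]_\theta$ and $R^{\mathcal{M}/\theta}([x_1]_\theta,\dots,[x_n]_\theta) \iff R^{\mathcal{M}}(x_1,\dots,x_n)$. If $\theta \subseteq \psi$ are congruences on $\mathcal{M}$, then $\psi/\theta = \{\, ([x]_\theta,[y]_\theta) \in (M/\theta)^2 \mid (x,y) \in \psi \,\}$, which is a congruence on $\mathcal{M}/\theta$. *)

(* Defs.v *)
From mathcomp Require Import all_boot.
From mathcomp Require Import boolp classical_sets.
From Corelib Require Import RelationClasses.

Set Implicit Arguments.
Unset Strict Implicit.
Unset Printing Implicit Defensive.

Local Open Scope classical_set_scope.

Record language := Language {
  fsymb : Type;
  rsymb : Type;
  farity : fsymb -> nat;
  rarity : rsymb -> nat }.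

(* Constants are function symbols of arity 0. The universe may be empty. *)
Record structure (L : language) := Structure {
  univ :> Type;
  finterp : forall F : fsymb L, (farity F).-tuple univ -> univ;
  rinterp : forall R : rsymb L, (rarity R).-tuple univ -> Prop }.

Arguments finterp {L} _ F _.
Arguments rinterp {L} _ R _.

Section Morphisms.
Variables (L : language) (M N : structure L).

Definition strong_hom (f : M -> N) : Prop :=
  (forall (F : fsymb L) (x : (farity F).-tuple M),
      f (finterp M F x) = finterp N F (map_tuple f x)) /\
  (forall (R : rsymb L) (x : (rarity R).-tuple M),
      rinterp M R x <-> rinterp N R (map_tuple f x)).

Definition isomorphic : Prop :=
  exists f : M -> N, strong_hom f /\ bijective f.

End Morphisms.

Section Congruences.
Variables (L : language) (M : structure L).

Record congruence := Congruence {
  crel :> M -> M -> Prop;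
  crel_equiv : Equivalence crel;
  crel_fun : forall (F : fsymb L) (x y : (farity F).-tuple M),
    (forall i, crel (tnth x i) (tnth y i)) ->
    crel (finterp M F x) (finterp M F y);
  crel_rel : forall (R : rsymb L) (x y : (rarity R).-tuple M),
    (forall i, crel (tnth x i) (tnth y i)) ->
    rinterp M R x <-> rinterp M R y }.

End Congruences.

Section Quotient.
Variables (L : language) (M : structure L) (theta : congruence M).

Definition qclass (x : M) : set M := [set y | theta x y].

Definition quot_univ : Type := {A : set M | exists x, A = qclass x}.

Definition qpi (x : M) : quot_univ := exist _ (qclass x) (ex_intro _ x erefl).

Definition qrepr (q : quot_univ) : M := sval (cid (svalP q)).

(* Interpretations go through chosen representatives; [quot_finterpE] and
   [quot_rinterpE] below show that the choice is immaterial. *)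
Definition quot : structure L := {|
  univ := quot_univ;
  finterp := fun F q => qpi (finterp M F (map_tuple qrepr q));
  rinterp := fun R q => rinterp M R (map_tuple qrepr q) |}.

Lemma qpiP (x y : M) : qpi x = qpi y <-> theta x y.
Proof.
have [r s t] := crel_equiv theta; split=> [[exy]|xy].
  by have : qclass y y := r y; rewrite -exy.
apply: eq_exist; apply/predeqP => z; split=> h; last exact: t xy h.
exact: t (s _ _ xy) h.
Qed.

Lemma qreprK (q : quot_univ) : qpi (qrepr q) = q.
Proof.
by case: q => A hA; apply: eq_exist; rewrite /qrepr /=; case: cid.
Qed.

Lemma qrepr_pi (x : M) : theta (qrepr (qpi x)) x.
Proof. by apply/qpiP; exact: qreprK. Qed.

Lemma quot_finterpE (F : fsymb L) (x : (farity F).-tuple M) :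
  finterp quot F (map_tuple qpi x) = qpi (finterp M F x).
Proof.
by apply/qpiP/crel_fun => i; rewrite !tnth_map; exact: qrepr_pi.
Qed.

Lemma quot_rinterpE (R : rsymb L) (x : (rarity R).-tuple M) :
  rinterp quot R (map_tuple qpi x) <-> rinterp M R x.
Proof.
by apply (crel_rel (c := theta)) => i; rewrite !tnth_map; exact: qrepr_pi.
Qed.

End Quotient.

Section QuotientCongruence.
Variables (L : language) (M : structure L) (theta psi : congruence M).
Hypothesis theta_psi : forall x y : M, theta x y -> psi x y.

Definition quot_crel (p q : quot theta) : Prop :=
  exists x y : M, [/\ p = qpi theta x, q = qpi theta y & psi x y].

Lemma quot_crelP (p q : quot theta) :
  quot_crel p q <-> psi (qrepr p) (qrepr q).
Proof.
have [r s t] := crel_equiv psi; split=> [[x [y [-> -> xy]]]|h]; last first.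
  by exists (qrepr p), (qrepr q); rewrite !qreprK.
have hx := theta_psi (qrepr_pi theta x).
have hy := theta_psi (qrepr_pi theta y).
exact: t hx (t _ _ _ xy (s _ _ hy)).
Qed.

Lemma quot_crel_equiv : Equivalence quot_crel.
Proof.
have [r s t] := crel_equiv psi; split.
- by move=> p; apply/quot_crelP; exact: r.
- by move=> p q /quot_crelP h; apply/quot_crelP; exact: s.
- move=> p q u /quot_crelP h /quot_crelP k; apply/quot_crelP; exact: t h k.
Qed.

Lemma quot_crel_fun (F : fsymb L) (p q : (farity F).-tuple (quot theta)) :
  (forall i, quot_crel (tnth p i) (tnth q i)) ->
  quot_crel (finterp (quot theta) F p) (finterp (quot theta) F q).
Proof.
move=> pq; do 2!eexists; split; [reflexivity | reflexivity |].
by apply: crel_fun => i; rewrite !tnth_map; apply/quot_crelP.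
Qed.

Lemma quot_crel_rel (R : rsymb L) (p q : (rarity R).-tuple (quot theta)) :
  (forall i, quot_crel (tnth p i) (tnth q i)) ->
  rinterp (quot theta) R p <-> rinterp (quot theta) R q.
Proof.
move=> pq; apply (crel_rel (c := psi)) => i.
by rewrite !tnth_map; apply/quot_crelP.
Qed.

Definition quot_congruence : congruence (quot theta) :=
  Congruence quot_crel_equiv quot_crel_fun quot_crel_rel.

End QuotientCongruence.

(* Main.v *)
From mathcomp Require Import all_boot.
Require Import Defs.

(** The isomorphism is [[x]_theta]_(psi/theta) |-> [x]_psi. On chosen
    representatives it does not depend on the choices, since two applications of
    [qrepr] to the iterated class of [x] return an element [psi]-related to [x]. *)

(** The representatives witnessing [quot_crel] may differ from [x] and [y], but only up to [theta],
    hence up to [psi]. *)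
Lemma quot_congruence_pi {L : language} {M : structure L}
    {theta psi : congruence M} (theta_psi : forall x y : M, theta x y -> psi x y)
    (x y : M) :
  quot_congruence theta_psi (qpi theta x) (qpi theta y) <-> psi x y.
Proof.
have [_ s t] := crel_equiv psi.
split=> [[x' [y' [/qpiP/theta_psi xx' /qpiP/theta_psi yy' x'y']]]|xy].
  exact: t xx' (t _ _ _ x'y' (s _ _ yy')).
by exists x, y.
Qed.

Lemma qrepr_qrepr_pi {L : language} {M : structure L}
    {theta psi : congruence M} (theta_psi : forall x y : M, theta x y -> psi x y)
    (x : M) :
  psi (qrepr (qrepr (qpi (quot_congruence theta_psi) (qpi theta x)))) x.
Proof.
by apply/(quot_congruence_pi theta_psi); rewrite qreprK; exact: qrepr_pi.
Qed.

Lemma map_tuple_comp {T1 T2 T3 : Type} (f : T2 -> T3) (g : T1 -> T2) {n : nat}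
    (x : n.-tuple T1) :
  map_tuple (fun u => f (g u)) x = map_tuple f (map_tuple g x).
Proof. by apply: eq_from_tnth => i; rewrite !tnth_map. Qed.

Theorem theorem4p6 (L : language) (M : structure L) (theta psi : congruence M)
    (theta_psi : forall x y : M, theta x y -> psi x y) :
  isomorphic (quot (quot_congruence theta_psi)) (quot psi).
Proof.
pose r (q : quot (quot_congruence theta_psi)) : M :=
  qrepr (qrepr q : quot theta).
exists (fun q => qpi psi (r q)); split; first split.
- move=> F q; rewrite (map_tuple_comp (qpi psi) r) quot_finterpE /r.
  (* The iterated [finterp] unfolds to the double class of [F] at double representatives. *)
  by rewrite map_tuple_comp; apply/qpiP; exact: qrepr_qrepr_pi.
- move=> R q; rewrite (map_tuple_comp (qpi psi) r).
  (* Both sides unfold to [R] in [M] at the same double representatives. *)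
  by rewrite quot_rinterpE /r map_tuple_comp.
- exists (fun p => qpi (quot_congruence theta_psi) (qpi theta (qrepr p))) => q.
    (* Writing [q] as the double class of [r q] reduces the equality to [psi] on [M]. *)
    rewrite -[RHS]qreprK -[qrepr q in RHS]qreprK.
    by apply/qpiP/quot_congruence_pi; exact: qrepr_pi.
  by rewrite -[RHS]qreprK; apply/qpiP; exact: qrepr_qrepr_pi.
Qed.
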